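(* Let $\Gamma$ be a connected regular graph with vertex set $V$, degree $k$, $n$ vertices, and spectrum $\{\theta_0^{1},\theta_1^{m_1},\theta_2^{m_2},\theta_3^{m_3}\}$ (exactly four distinct adjacency eigenvalues, exponents denoting multiplicities, $m_0=1$), where $\theta_0=k>\theta_1>\theta_2>\theta_3$, and let $\gamma_2$ be its preintersection number. Let $k_3(u)$ be the number of vertices at distance $3$ from $u$ in $\Gamma$, and let $\overline{k_3}=\frac{1}{n}\sum_{u\in V}k_3(u)$. Consider the polynomials $$s_1(x)=x^2-(\theta_1+\theta_3)x+\gamma_2+\theta_2(\theta_1-\theta_2+\theta_3),$$ $$s_2(x)=x^2-(\theta_1+\theta_2)x+\gamma_2+\theta_3(\theta_1-\theta_3+\theta_2).$$ Then, for $j=1,2$, $$\overline{k_3}\le \frac{n\sum_{i=1}^3 m_i(s_j(\theta_i)-\tau_j)^2}{\sum_{i=0}^3 m_i(s_j(\theta_i)-\tau_j)^2},\qquad\text{where}\quad \tau_j=\frac{s_j(\theta_0)\sum_{i=1}^3 m_i s_j(\theta_i)-\sum_{i=1}^3 m_i s_j(\theta_i)^2}{s_j(\theta_0)(n-1)-\sum_{i=1}^3 m_i s_j(\theta_i)}.$$ Moreover, equality holds in this inequality for some $j\in\{1,2\}$ if and only if $\Gamma$ is a distance-regular graph and its distance-$1$-or-$2$ graph $\Gamma_{1,2}$ is strongly regular.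
   Context: Graphs are finite, simple and undirected. The distance-$1$-or-$2$ graph $\Gamma_{1,2}$ has the same vertices as $\Gamma$, two vertices being adjacent if and only if they are at distance $1$ or $2$ in $\Gamma$. A strongly regular graph is a regular graph, neither complete nor edgeless, in which the number of common neighbours of two distinct vertices depends only on whether they are adjacent or not; it is not required to be connected. The preintersection number $\gamma_2$ is the constant such that the degree-$2$ predistance polynomial of $\Gamma$ is $p_2(x)=\frac1{\gamma_2}(x^2-\alpha_1x-k)$; explicitly, with $\overline{\mathcal C}_{\ell}=\frac1n\sum_{i=0}^3 m_i\theta_i^{\ell}$, one has $\alpha_1=\overline{\mathcal C}_3/\overline{\mathcal C}_2$ and $$\gamma_2=\frac{\overline{\mathcal C}_{3}^2-\overline{\mathcal C}_{4}k+k^3}{k(\overline{\mathcal C}_{3}+k-k^2)}.$$ *)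

(* Defs.v *)
From HB Require Import structures.
From mathcomp Require Import all_boot all_order all_algebra.

Set Implicit Arguments.
Unset Strict Implicit.
Unset Printing Implicit Defensive.

Import Order.TTheory GRing.Theory Num.Theory.

(* A graph is a relation [e] on a finite type; the theorem assumes it symmetric
   and irreflexive. *)

Definition graph_connected (T : finType) (e : rel T) : Prop :=
  forall u v : T, connect e u v.

Definition regular_of_degree (T : finType) (e : rel T) (k : nat) : Prop :=
  forall u : T, #|[set v | e u v]| = k.

Definition walk_of_length (T : finType) (e : rel T) (d : nat) (u v : T) : bool :=
  [exists p : d.-tuple T, path e u p && (last u p == v)].

(* Never true for vertices in different components, so no value has to be
   invented for an infinite distance. *)
Definition at_distance (T : finType) (e : rel T) (d : nat) (u v : T) : bool :=
  walk_of_length e d u v && [forall j : 'I_d, ~~ walk_of_length e j u v].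

Definition dist12_graph (T : finType) (e : rel T) : rel T :=
  [rel u v | at_distance e 1 u v || at_distance e 2 u v].

(* [b] and [c] are the usual intersection numbers b_i, c_i. For i = 0 one has
   [i.-1 = 0] and v = u, so the second set is empty for a loopless graph,
   consistently with c_0 = 0. *)
Definition distance_regular (T : finType) (e : rel T) : Prop :=
  graph_connected e /\
  exists b c : nat -> nat, forall (i : nat) (u v : T), at_distance e i u v ->
    #|[set w | e v w & at_distance e i.+1 u w]| = b i /\
    #|[set w | e v w & at_distance e i.-1 u w]| = c i.

Definition strongly_regular (T : finType) (e : rel T) : Prop :=
  [/\ exists k : nat, regular_of_degree e k,
      exists u v : T, u != v /\ ~~ e u v,
      exists u v : T, e u v
    & exists lambda mu : nat, forall u v : T, u != v ->
        #|[set w | e u w & e v w]| = if e u v then lambda else mu].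

Definition k3 (T : finType) (e : rel T) (u : T) : nat :=
  #|[set v | at_distance e 3 u v]|.

Local Open Scope ring_scope.

Definition adjacency_mx (R : nzRingType) (T : finType) (e : rel T) : 'M[R]_#|T| :=
  \matrix_(i, j) (e (enum_val i) (enum_val j))%:R.

(* Spectrum { theta_0^(m_0), ..., theta_3^(m_3) }; only the values of [theta]
   and [m] at 0, ..., 3 are used, here and below. *)
Definition has_spectrum4 (R : rcfType) (T : finType) (e : rel T)
    (theta : nat -> R) (m : nat -> nat) : Prop :=
  [/\ theta 3%N < theta 2%N, theta 2%N < theta 1%N, theta 1%N < theta 0%N,
      forall i : nat, (i < 4)%N -> (0 < m i)%N
    & char_poly (adjacency_mx R e) =
        \prod_(0 <= i < 4) ('X - (theta i)%:P) ^+ m i].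

Definition k3_mean (R : rcfType) (T : finType) (e : rel T) : R :=
  (\sum_(u : T) (k3 e u)%:R) / #|T|%:R.

Definition spectral_moment (R : rcfType) (n : nat) (theta : nat -> R) (m : nat -> nat)
    (l : nat) : R :=
  n%:R^-1 * \sum_(0 <= i < 4) (m i)%:R * theta i ^+ l.

(* The predistance polynomial of degree 2 is
   ('X^2 - (C 3 / C 2) 'X - k) / gamma2 with C = spectral_moment; this is the
   resulting closed form. *)
Definition gamma2 (R : rcfType) (n : nat) (theta : nat -> R) (m : nat -> nat) : R :=
  let C := spectral_moment n theta m in
  let k := theta 0%N in
  (C 3%N ^+ 2 - C 4%N * k + k ^+ 3) / (k * (C 3%N + k - k ^+ 2)).

Definition s1 (R : rcfType) (n : nat) (theta : nat -> R) (m : nat -> nat) : {poly R} :=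
  'X^2 - (theta 1%N + theta 3%N) *: 'X
  + (gamma2 n theta m + theta 2%N * (theta 1%N - theta 2%N + theta 3%N))%:P.

Definition s2 (R : rcfType) (n : nat) (theta : nat -> R) (m : nat -> nat) : {poly R} :=
  'X^2 - (theta 1%N + theta 2%N) *: 'X
  + (gamma2 n theta m + theta 3%N * (theta 1%N - theta 3%N + theta 2%N))%:P.

(* For s = s2 the denominator is n k (k - theta_1 - theta_2 - 1), which can be 0
   (line graph of the triangular graph T(7)); then [tau] is 0. *)
Definition tau (R : rcfType) (n : nat) (theta : nat -> R) (m : nat -> nat)
    (s : {poly R}) : R :=
  (s.[theta 0%N] * (\sum_(1 <= i < 4) (m i)%:R * s.[theta i])
     - \sum_(1 <= i < 4) (m i)%:R * s.[theta i] ^+ 2)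
  / (s.[theta 0%N] * (n%:R - 1) - \sum_(1 <= i < 4) (m i)%:R * s.[theta i]).

Definition k3_bound (R : rcfType) (n : nat) (theta : nat -> R) (m : nat -> nat)
    (s : {poly R}) : R :=
  (n%:R * \sum_(1 <= i < 4) (m i)%:R * (s.[theta i] - tau n theta m s) ^+ 2)
  / \sum_(0 <= i < 4) (m i)%:R * (s.[theta i] - tau n theta m s) ^+ 2.

(* Main.v *)
(* Proof idea.  Let N be the 0/1 matrix of the pairs at distance at most 2; the
   Hoffman polynomial shows that all other pairs are at distance 3.  For a
   quadratic p, the matrix p(A) is supported on N, has entry sum n p(theta_0) and
   squared norm sum_i m_i p(theta_i)^2, so Cauchy-Schwarz bounds the number of
   nonzero entries of N from below.  With p = s_j - tau_j this is the inequality,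
   and equality means that p(A) is a multiple of N.  Then I, A, N, J span an
   algebra, which gives distance-regularity, and since s_j takes at most two
   values on theta_1, theta_2, theta_3, the matrix N - I of the distance-1-or-2
   graph has at most two eigenvalues besides its valency.  Conversely, for a
   distance-regular graph a multiple of N is q(A) with q a monic quadratic;
   orthogonality of q forces q(theta_2) to differ from q(theta_1) and
   q(theta_3), so strong regularity means q(theta_1) = q(theta_3), that is,
   q and s_1 differ by a constant, and this constant is tau_1.  In particular
   equality never holds for j = 2, and the value of gamma_2 is
   immaterial: the constant term of s_j cancels in s_j - tau_j. *)

Require Import Defs.
From HB Require Import structures.
From mathcomp Require Import all_boot all_order all_algebra.
From mathcomp Require Import complex ring lra.

Set Implicit Arguments.
Unset Strict Implicit.
Unset Printing Implicit Defensive.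

Import Order.TTheory GRing.Theory Num.Theory.
Local Open Scope ring_scope.

(** * Traces of polynomials in a symmetric matrix *)

Lemma char_poly_uconjC (F : fieldType) n (P D : 'M[F]_n) :
  P \in unitmx -> char_poly (invmx P *m D *m P) = char_poly D.
Proof.
move=> unitP; rewrite /char_poly.
have -> : char_poly_mx (invmx P *m D *m P) =
    map_mx polyC (invmx P) *m char_poly_mx D *m map_mx polyC P.
  rewrite /char_poly_mx mulmxBr mulmxBl !map_mxM; congr (_ - _).
  by rewrite scalar_mxC -mulmxA -map_mxM mulVmx // map_mx1 mulmx1.
by rewrite !det_mulmx mulrAC -det_mulmx -map_mxM mulVmx // map_mx1 det1 mul1r.
Qed.

(* The spectral theorem is available over a closed field, hence the detour
   through R[i]. *)
Lemma trace_horner_mx_sym (R : rcfType) n (A : 'M[R]_n.+1) (s : seq R) p :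
  A^T = A -> char_poly A = \prod_(x <- s) ('X - x%:P) ->
  \tr (horner_mx A p) = \sum_(x <- s) p.[x].
Proof.
move=> symA charA; pose toC : {rmorphism R -> R[i]} := real_complex R.
pose AC := map_mx toC A; pose pC := map_poly toC p.
have AC_normal : AC \is normalmx.
  apply/normalmxP; suff -> : map_mx Num.conj AC^T = AC by [].
  apply/matrixP => i j; rewrite !mxE -[in RHS]symA mxE.
  by apply/CrealP; rewrite /toC /= complex_real.
have /orthomx_spectralP ACE := AC_normal.
set P := spectralmx AC in ACE; set d := spectral_diag AC in ACE.
have unitP : P \in unitmx := spectral_unit AC.
have charAC : char_poly AC = \prod_(i < n.+1) ('X - (d 0 i)%:P).
  rewrite [AC in char_poly AC]ACE char_poly_uconjC //.
  rewrite char_poly_trig ?diag_mx_is_trig //.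
  by apply: eq_bigr => i _; rewrite mxE eqxx.
(* Two factorizations of the characteristic polynomial into monic linear factors agree up to order,
   so the diagonal of the spectral form is [s] up to a permutation. *)
have perm_d : perm_eq [seq d 0 i | i <- index_enum 'I_n.+1] [seq toC x | x <- s].
  apply: prod_XsubC_eq; rewrite big_map -charAC big_map.
  rewrite -map_char_poly charA rmorph_prod; apply: eq_bigr => x _.
  by rewrite rmorphB /= map_polyX map_polyC.
apply: (fmorph_inj toC); rewrite -trace_map_mx map_horner_mx -/AC -/pC.
rewrite [AC in horner_mx AC _]ACE horner_mx_uconjC // -mulmxA mxtrace_mulC mulmxK //.
rewrite horner_mx_diag mxtrace_diag rmorph_sum /=.
under eq_bigr do rewrite mxE.
rewrite -[LHS](big_map (fun i => d 0 i) xpredT (fun x => pC.[x])).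
by rewrite (perm_big _ perm_d) big_map; apply: eq_bigr => x _; rewrite horner_map.
Qed.

(* [horner_mx] only accepts orders of the form [n'.+1], which [#|V|] is not; the
   junk value at order 0 is the only matrix there is. *)
Definition sqmx_horner (R : comNzRingType) n : 'M[R]_n -> {poly R} -> 'M[R]_n :=
  if n is n'.+1 then fun A p => horner_mx A p else fun _ _ => 0.

Section SqmxHorner.
Variables (R : comNzRingType) (n : nat) (A : 'M[R]_n).

Fact sqmx_horner_is_linear : linear (sqmx_horner A).
Proof. by case: n A => [|n'] B c p q; [apply/matrixP => -[] | apply: linearP]. Qed.
HB.instance Definition _ := GRing.isLinear.Build R {poly R} 'M[R]_n *:%R
  (sqmx_horner A) sqmx_horner_is_linear.

Lemma sqmx_hornerM p q : sqmx_horner A (p * q) = sqmx_horner A p *m sqmx_horner A q.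
Proof. by case: n A => [|n'] B; [apply/matrixP => -[] | apply: rmorphM]. Qed.

Lemma sqmx_hornerC c : sqmx_horner A c%:P = c%:M.
Proof. by case: n A => [|n'] B; [apply/matrixP => -[] | apply: horner_mx_C]. Qed.

Lemma sqmx_hornerX : sqmx_horner A 'X = A.
Proof. by case: n A => [|n'] B; [apply/matrixP => -[] | apply: horner_mx_X]. Qed.

Lemma tr_sqmx_horner p : A^T = A -> (sqmx_horner A p)^T = sqmx_horner A p.
Proof.
move=> symA; elim/poly_ind: p => [|p c IHp]; first by rewrite linear0 trmx0.
rewrite linearD /= sqmx_hornerM sqmx_hornerC sqmx_hornerX linearD /= trmx_mul.
rewrite tr_scalar_mx symA IHp; congr (_ + _).
by have := sqmx_hornerM 'X p; rewrite mulrC sqmx_hornerM sqmx_hornerX.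
Qed.

End SqmxHorner.

Lemma trace_sqmx_horner_sym (R : rcfType) n (A : 'M[R]_n) (s : seq R) p :
  (0 < n)%N -> A^T = A -> char_poly A = \prod_(x <- s) ('X - x%:P) ->
  \tr (sqmx_horner A p) = \sum_(x <- s) p.[x].
Proof. by case: n A => // n A _; apply: trace_horner_mx_sym. Qed.

(** * Symmetric matrices with four eigenvalues *)

Section FourEigenvalues.

Variables (R : rcfType) (n : nat) (A : 'M[R]_n).
Variables (theta : nat -> R) (m : nat -> nat).
Hypothesis symA : A^T = A.
Hypothesis thetaA : A *m const_mx 1 = theta 0%N *: const_mx 1 :> 'M_n.
Hypothesis charA : char_poly A = \prod_(0 <= i < 4) ('X - (theta i)%:P) ^+ m i.
Hypothesis m_gt0 : forall i, (i < 4)%N -> (0 < m i)%N.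
Hypothesis m0 : m 0%N = 1%N.
Hypothesis theta_inj : forall i, (0 < i < 4)%N -> theta i != theta 0%N.

Local Notation f := (sqmx_horner A).
Local Notation J := (const_mx 1 : 'M[R]_n).

(** At order 0 the characteristic polynomial is 1, whereas here it has the root [theta 0]. *)
Lemma order_gt0 : (0 < n)%N.
Proof.
have rootA : root (char_poly A) (theta 0%N).
  by rewrite charA big_nat_recl //= m0 expr1 rootM root_XsubC eqxx.
rewrite lt0n; apply: contraTneq rootA => n0; move: A; rewrite n0 => B.
by rewrite /char_poly det_mx00 root1.
Qed.

Lemma trace_sqmx_horner p : \tr (f p) = \sum_(0 <= i < 4) (m i)%:R * p.[theta i].
Proof.
pose s := flatten [seq nseq (m i) (theta i) | i <- iota 0 4].
have charAs : char_poly A = \prod_(x <- s) ('X - x%:P).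
  rewrite charA big_flatten big_map; apply: eq_bigr => i _.
  by rewrite big_nseq iter_mulr_1.
have -> : \sum_(0 <= i < 4) (m i)%:R * p.[theta i] = \sum_(x <- s) p.[x].
  rewrite big_flatten big_map; apply: eq_bigr => i _.
  by rewrite big_nseq iter_addr_0 mulr_natl.
exact: trace_sqmx_horner_sym order_gt0 symA charAs.
Qed.

Lemma sum_mult : \sum_(0 <= i < 4) (m i)%:R = n%:R :> R.
Proof.
have := trace_sqmx_horner 1; rewrite -[1]/(1%:P) sqmx_hornerC mxtrace_scalar => ->.
by apply: eq_bigr => i _; rewrite hornerC mulr1.
Qed.

Lemma sqmx_horner_ones p : f p *m J = p.[theta 0%N] *: J.
Proof.
elim/poly_ind: p => [|p c IHp]; first by rewrite linear0 mul0mx horner0 scale0r.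
rewrite linearD /= sqmx_hornerM sqmx_hornerX sqmx_hornerC mulmxDl -mulmxA.
rewrite thetaA -scalemxAr IHp mul_scalar_mx scalerA -scalerDl hornerMXaddC.
by rewrite mulrC.
Qed.

(** For symmetric [M] the trace of its square is the sum of the squares of its entries. This turns
    matrix identities into trace computations. *)
Lemma symmx_sqr_trace0 (M : 'M[R]_n) : M^T = M -> \tr (M *m M) = 0 -> M = 0.
Proof.
move=> symM; have sqE i : (M *m M) i i = \sum_j M i j ^+ 2.
  by rewrite mxE; apply: eq_bigr => j _; rewrite -{2}symM mxE.
move/eqP; rewrite /mxtrace psumr_eq0 => [/allP tr0|i _]; last first.
  by rewrite sqE sumr_ge0 // => j _; apply: sqr_ge0.
apply/matrixP => i j; have := tr0 i (mem_index_enum i); rewrite sqE /=.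
rewrite psumr_eq0 => [/allP /(_ j (mem_index_enum j)) /=|l _]; last exact: sqr_ge0.
by rewrite sqrf_eq0 mxE => /eqP.
Qed.

(** Both sides say that the trace of the square of [f p], which is the sum of the m_i p(theta_i)^2
    with all m_i positive, is zero. *)
Lemma sqmx_horner_eq0 p :
  f p = 0 <-> forall i, (i < 4)%N -> p.[theta i] = 0.
Proof.
have trE : \tr (f p *m f p) = \sum_(0 <= i < 4) (m i)%:R * p.[theta i] ^+ 2.
  rewrite -sqmx_hornerM trace_sqmx_horner; apply: eq_bigr => i _.
  by rewrite hornerM.
split=> [fp0 i i4 | p0]; last first.
  apply: symmx_sqr_trace0; first exact: tr_sqmx_horner.
  by rewrite trE big_nat big1 // => i /andP[_ i4]; rewrite p0 // expr0n mulr0.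
move: trE; rewrite fp0 mul0mx mxtrace0 => /esym/eqP.
rewrite psumr_eq0 => [|j _]; last by rewrite mulr_ge0 ?ler0n ?sqr_ge0.
move/allP/(_ i); rewrite mem_index_iota => /(_ i4) /=.
by rewrite mulf_eq0 sqrf_eq0 pnatr_eq0 eqn0Ngt m_gt0 //= => /eqP.
Qed.

Lemma ones_mul : J *m J = n%:R *: J.
Proof.
apply/matrixP => i j; rewrite !mxE (eq_bigr (fun _ => 1)) => [|l _].
  by rewrite sumr_const card_ord mulr1.
by rewrite !mxE mulr1.
Qed.

Lemma trace_ones : \tr J = n%:R.
Proof.
by rewrite /mxtrace (eq_bigr (fun _ => 1)) ?sumr_const ?card_ord // => l _; rewrite mxE.
Qed.

(** Multiplying by A - theta_0 kills [J], so p(x) (x - theta_0) vanishes at every eigenvalue, and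
    the second factor is nonzero at theta_1, theta_2, theta_3. *)
Lemma sqmx_horner_scale_ones p c : f p = c *: J ->
  forall i, (0 < i < 4)%N -> p.[theta i] = 0.
Proof.
move=> fpE i i4; suff /sqmx_horner_eq0/(_ i) : f (p * ('X - (theta 0%N)%:P)) = 0.
  case/andP: (i4) => _ -> /(_ isT) /eqP; rewrite hornerM hornerXsubC mulf_eq0.
  by rewrite subr_eq0 (negPf (theta_inj i4)) orbF => /eqP.
rewrite mulrC sqmx_hornerM fpE linearB /= sqmx_hornerX sqmx_hornerC mulmxBl.
by rewrite -scalemxAr thetaA mul_scalar_mx !scalerA mulrC subrr.
Qed.

(** With c n = p(theta_0), the square of the symmetric matrix f p - c J has trace (c n)^2 - 2 (c
    n)^2 + (c n)^2 = 0; the first term is p(theta_0)^2 because theta_0 is simple. *)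
Lemma hoffman p : (forall i, (0 < i < 4)%N -> p.[theta i] = 0) ->
  f p = (p.[theta 0%N] / n%:R) *: J.
Proof.
move=> p0; set c := _ / _; have n_neq0 : n%:R != 0 :> R.
  by rewrite pnatr_eq0 -lt0n order_gt0.
have cn : p.[theta 0%N] = c * n%:R by rewrite divfK.
apply/eqP; rewrite -subr_eq0; apply/eqP; apply: symmx_sqr_trace0.
  by rewrite linearB /= linearZ /= trmx_const tr_sqmx_horner.
have fJ : f p *m J = (c * n%:R) *: J by rewrite -cn sqmx_horner_ones.
have Jf : J *m f p = (c * n%:R) *: J.
  by rewrite -[LHS]trmxK trmx_mul trmx_const tr_sqmx_horner // fJ linearZ /= trmx_const.
rewrite mulmxBl !mulmxBr -!scalemxAl -!scalemxAr fJ Jf ones_mul -sqmx_hornerM.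
rewrite !linearB /= !linearZ /= trace_ones trace_sqmx_horner big_nat_recl // big_nat big1.
  by rewrite m0 hornerM cn; ring.
by move=> i i4; rewrite hornerM p0 ?mulr0.
Qed.

End FourEigenvalues.

(** * Distances up to 3 and counting with matrices *)

Lemma walk0E (T : finType) (e : rel T) u v : walk_of_length e 0 u v = (u == v).
Proof.
apply/existsP/idP => [[p]|uv]; first by rewrite tuple0.
by exists [tuple]; rewrite /=.
Qed.

Lemma walkSE (T : finType) (e : rel T) d u v :
  walk_of_length e d.+1 u v = [exists w, e u w && walk_of_length e d w v].
Proof.
apply/existsP/existsP => [[p]|[w /andP[uw /existsP[p pP]]]].
  case/tupleP: p => w p /= /andP[/andP[uw pP] lastp].
  by exists w; rewrite uw; apply/existsP; exists p; rewrite pP.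
by exists [tuple of w :: p]; rewrite /= uw.
Qed.

Lemma walk1E (T : finType) (e : rel T) u v : walk_of_length e 1 u v = e u v.
Proof.
rewrite walkSE; apply/existsP/idP => [[w]|uv]; last by exists v; rewrite uv walk0E eqxx.
by rewrite walk0E => /andP[? /eqP <-].
Qed.

Lemma walk2E (T : finType) (e : rel T) u v :
  walk_of_length e 2 u v = [exists w, e u w && e w v].
Proof. by rewrite walkSE; apply: eq_existsb => w; rewrite walk1E. Qed.

Lemma forall_ord_lt n (P : pred nat) : [forall j : 'I_n, P j] = all P (iota 0 n).
Proof.
apply/forallP/allP => [Pn i|Pn j]; last by apply: Pn; rewrite mem_iota /=.
by rewrite mem_iota /= => i_n; apply: (Pn (Ordinal i_n)).
Qed.

Section Distance.
Variables (T : finType) (e : rel T).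
Hypothesis e_irr : irreflexive e.

Definition near : rel T := fun u v => (u == v) || dist12_graph e u v.

Lemma at_distance0E u v : at_distance e 0 u v = (u == v).
Proof.
rewrite /at_distance walk0E (forall_ord_lt _ (fun j => ~~ walk_of_length e j u v)).
by rewrite andbT.
Qed.

Lemma at_distance1E u v : at_distance e 1 u v = e u v.
Proof.
rewrite /at_distance walk1E (forall_ord_lt _ (fun j => ~~ walk_of_length e j u v)) /=.
by rewrite walk0E andbT; case: eqP => [->|]; rewrite ?e_irr ?andbT.
Qed.

Lemma at_distance2E u v : at_distance e 2 u v =
  [&& [exists w, e u w && e w v], u != v & ~~ e u v].
Proof.
rewrite /at_distance walk2E (forall_ord_lt _ (fun j => ~~ walk_of_length e j u v)) /=.
by rewrite walk0E walk1E andbT.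
Qed.

Lemma dist12E u v :
  dist12_graph e u v = e u v || [exists w, e u w && e w v] && (u != v).
Proof.
rewrite /dist12_graph /= at_distance1E at_distance2E.
by case: (e u v); rewrite ?andbT.
Qed.

Lemma nearE u v : near u v = [|| u == v, e u v | [exists w, e u w && e w v]].
Proof. by rewrite /near dist12E; case: eqP; rewrite //= ?andbT. Qed.

Lemma at_distance3E u v : at_distance e 3 u v = walk_of_length e 3 u v && ~~ near u v.
Proof.
rewrite /at_distance (forall_ord_lt _ (fun j => ~~ walk_of_length e j u v)) /=.
by rewrite walk0E walk1E walk2E nearE andbT !negb_or.
Qed.

Lemma at_distance_walkN d d' u v :
  at_distance e d u v -> (d' < d)%N -> ~~ walk_of_length e d' u v.
Proof. by case/andP=> _ /forallP far d'_d; apply: (far (Ordinal d'_d)). Qed.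

End Distance.

(** * Matrices indexed by vertices *)

Section Entry.
Variables (R : comNzRingType) (T : finType).
Implicit Types (M N : 'M[R]_#|T|) (g h : rel T).

(** Matrices have ordinal indices; going through [enum_rank] lets entries be read as counts of
    vertices. *)
Definition entry M u v := M (enum_rank u) (enum_rank v).

Lemma entryP M N : (forall u v, entry M u v = entry N u v) -> M = N.
Proof.
move=> MN; apply/matrixP => i j.
by rewrite -(enum_valK i) -(enum_valK j); apply: MN.
Qed.

Lemma sum_ord_rank (F : 'I_#|T| -> R) : \sum_i F i = \sum_u F (enum_rank u).
Proof.
rewrite (reindex enum_rank) //.
by exists enum_val => i _; rewrite ?enum_valK ?enum_rankK.
Qed.

Lemma entry_mul M N u v : entry (M *m N) u v = \sum_w entry M u w * entry N w v.
Proof. by rewrite /entry mxE sum_ord_rank. Qed.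

Lemma trace_entry M : \tr M = \sum_u entry M u u.
Proof. by rewrite /mxtrace sum_ord_rank. Qed.

Lemma entryD M N u v : entry (M + N) u v = entry M u v + entry N u v.
Proof. by rewrite /entry mxE. Qed.

Lemma entryN M u v : entry (- M) u v = - entry M u v.
Proof. by rewrite /entry mxE. Qed.

Lemma entryZ c M u v : entry (c *: M) u v = c * entry M u v.
Proof. by rewrite /entry mxE. Qed.

Lemma entry_scalar c u v : entry c%:M u v = c * (u == v)%:R.
Proof. by rewrite /entry mxE (inj_eq enum_rank_inj) mulr_natr. Qed.

Lemma entry_const c u v : entry (const_mx c) u v = c.
Proof. by rewrite /entry mxE. Qed.

Lemma entry_adj g u v : entry (adjacency_mx R g) u v = (g u v)%:R.
Proof. by rewrite /entry mxE !enum_rankK. Qed.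

Lemma sum_count (P : pred T) : \sum_u (P u)%:R = #|[set u | P u]|%:R :> R.
Proof.
rewrite -sum1_card natr_sum [RHS]big_mkcond /=.
by apply: eq_bigr => u _; rewrite inE; case: (P u).
Qed.

Lemma entry_adj_mul g h u v :
  entry (adjacency_mx R g *m adjacency_mx R h) u v = #|[set w | g u w & h w v]|%:R.
Proof.
rewrite entry_mul -sum_count; apply: eq_bigr => w _.
by rewrite !entry_adj -natrM mulnb.
Qed.

Lemma ones_adj : const_mx 1 = adjacency_mx R (fun _ _ : T => true).
Proof. by apply: entryP => u v; rewrite entry_const entry_adj. Qed.

End Entry.

Definition entryE := (entryD, entryN, entryZ, entry_scalar, entry_const, entry_adj).

(** * Regular graphs with four eigenvalues *)

Section Graph.

Variables (R : rcfType) (V : finType) (e : rel V).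
Hypotheses (e_sym : symmetric e) (e_irr : irreflexive e).
Variables (k : nat) (theta : nat -> R) (m : nat -> nat).
Hypotheses (e_reg : regular_of_degree e k) (e_spec : has_spectrum4 e theta m).
Hypotheses (theta0 : theta 0%N = k%:R) (m0 : m 0%N = 1%N).

Local Notation A := (adjacency_mx R e).
Local Notation N := (adjacency_mx R (near e)).
Local Notation J := (const_mx 1 : 'M[R]_#|V|).
Local Notation f := (sqmx_horner A).

Lemma theta_lt : [/\ theta 3%N < theta 2%N, theta 2%N < theta 1%N & theta 1%N < theta 0%N].
Proof. by case: e_spec. Qed.

Lemma m_gt0 i : (i < 4)%N -> (0 < m i)%N.
Proof. by case: e_spec => _ _ _ + _; apply. Qed.

Lemma char_adj : char_poly A = \prod_(0 <= i < 4) ('X - (theta i)%:P) ^+ m i.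
Proof. by case: e_spec. Qed.

Lemma theta_neq0 i : (0 < i < 4)%N -> theta i != theta 0%N.
Proof.
by have [] := theta_lt; case: i => [|[|[|[|]]]] // ? ? ? _; rewrite lt_eqF //; lra.
Qed.

Lemma near_sym : symmetric (near e).
Proof.
move=> u v; rewrite !(nearE e_irr) eq_sym e_sym; congr [|| _, _ | _].
by apply: eq_existsb => w; rewrite andbC [e w u]e_sym [e v w]e_sym.
Qed.

Lemma tr_adj g : symmetric g -> (adjacency_mx R g)^T = adjacency_mx R g :> 'M_#|V|.
Proof. by move=> g_sym; apply/matrixP => i j; rewrite !mxE g_sym. Qed.

Lemma adj_ones : A *m J = theta 0%N *: J.
Proof.
apply: entryP => u v; rewrite ones_adj entry_adj_mul !entryE mulr1 theta0 -(e_reg u).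
by congr (_%:R); apply: eq_card => w; rewrite !inE andbT.
Qed.

Let symA : A^T = A := tr_adj e_sym.
Let f_trace := trace_sqmx_horner symA char_adj m0.
Let f_eq0 := sqmx_horner_eq0 symA char_adj m_gt0 m0.
Let f_ones := sqmx_horner_ones adj_ones.
Let f_eq_ones := sqmx_horner_scale_ones symA adj_ones char_adj m_gt0 m0 theta_neq0.
Let f_hoffman := hoffman symA adj_ones char_adj m0.
Let sum_m := sum_mult symA char_adj m0.

Lemma card_gt0 : 0 < #|V|%:R :> R.
Proof. by rewrite ltr0n (order_gt0 char_adj m0). Qed.

Definition quadratic (a b : R) : {poly R} := 'X^2 + a *: 'X + b%:P.

Lemma horner_quadratic a b x : (quadratic a b).[x] = x ^+ 2 + a * x + b.
Proof. by rewrite !hornerE. Qed.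

Lemma quadratic_roots_eq a b x y : x != y ->
  (quadratic a b).[x] = (quadratic a b).[y] -> a = - (x + y).
Proof.
rewrite !horner_quadratic -subr_eq0 => xy eqxy.
apply: (mulfI xy); apply/eqP; rewrite -subr_eq0; apply/eqP.
have -> : (x - y) * a - (x - y) * - (x + y) =
  (x ^+ 2 + a * x + b) - (y ^+ 2 + a * y + b) by ring.
by rewrite eqxy subrr.
Qed.

(** Three distinct roots would give both a = -(theta_3 + theta_2) and a = -(theta_2 + theta_1). *)
Lemma quadratic_neq0 a b : ~ forall i, (0 < i < 4)%N -> (quadratic a b).[theta i] = 0.
Proof.
move=> q0; have [t32 t21 _] := theta_lt.
have := quadratic_roots_eq (negbT (lt_eqF t32)) (etrans (q0 3%N isT) (esym (q0 2%N isT))).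
have := quadratic_roots_eq (negbT (lt_eqF t21)) (etrans (q0 2%N isT) (esym (q0 1%N isT))).
by lra.
Qed.

Lemma sqmx_quadratic a b : f (quadratic a b) = A *m A + a *: A + b%:M.
Proof.
by rewrite !linearD linearZ /= expr2 sqmx_hornerM sqmx_hornerX sqmx_hornerC.
Qed.

Lemma entry_adj_sqr u v : entry (A *m A) u v = #|[set w | e u w & e v w]|%:R.
Proof.
rewrite entry_adj_mul; congr (_%:R); apply: eq_card => w.
by rewrite !inE [e w v]e_sym.
Qed.

Lemma entry_adj_sqr_diag u : entry (A *m A) u u = k%:R.
Proof.
rewrite entry_adj_sqr -(e_reg u); congr (_%:R).
by apply: eq_card => w; rewrite !inE andbb.
Qed.

Lemma entry_far u v : ~~ near e u v ->
  [/\ u == v = false, e u v = false & entry (A *m A) u v = 0].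
Proof.
rewrite (nearE e_irr) !negb_or => /and3P[/negPf uv /negPf euv /existsPn no_path].
split=> //; rewrite entry_adj_sqr; apply/eqP; rewrite pnatr_eq0 cards_eq0.
by apply/eqP/setP => w; rewrite !inE [e v w]e_sym (negPf (no_path w)).
Qed.

Lemma quadratic_far a b u v : ~~ near e u v -> entry (f (quadratic a b)) u v = 0.
Proof.
by case/entry_far=> uv euv sq0; rewrite sqmx_quadratic !entryE uv euv sq0 /= !mulr0 !addr0.
Qed.

(** The Hoffman polynomial of the graph up to a nonzero scalar. *)
Definition hoffman_poly : {poly R} :=
  ('X - (theta 1%N)%:P) * ('X - (theta 2%N)%:P) * ('X - (theta 3%N)%:P).

Lemma sqmx_hoffman_poly : exists2 h, h != 0 & f hoffman_poly = h *: J.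
Proof.
exists (hoffman_poly.[theta 0%N] / #|V|%:R); last first.
  by apply: f_hoffman => -[|[|[|[|]]]] // _; rewrite !hornerE subrr; ring.
have [t32 t21 t10] := theta_lt.
rewrite mulf_neq0 ?invr_eq0 ?(gt_eqF card_gt0) // !hornerE.
by rewrite !mulf_neq0 // subr_eq0 gt_eqF //; lra.
Qed.

Lemma X_mul_quadratic a b : exists c d g,
  'X * quadratic a b = hoffman_poly + c *: quadratic a b + d *: 'X + g%:P.
Proof.
(* Elementary symmetric functions of the three roots; the witnesses come from dividing x q by the
   cubic and then the remainder by q. *)
pose e1 := theta 1%N + theta 2%N + theta 3%N.
pose e2 := theta 1%N * theta 2%N + theta 1%N * theta 3%N + theta 2%N * theta 3%N.
pose e3 := theta 1%N * theta 2%N * theta 3%N.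
exists (a + e1), (b - e2 - (a + e1) * a), (e3 - (a + e1) * b).
rewrite /quadratic /hoffman_poly /e1 /e2 /e3 -!mul_polyC; ring.
Qed.

(** Serves twice: the nonzero coefficient of [J] bounds the diameter by 3, and the reduction closes
    the span of I, A, N, J under multiplication by A. *)
Lemma adj_mul_quadratic a b : exists2 h, h != 0 & exists c d g,
  A *m f (quadratic a b) = h *: J + c *: f (quadratic a b) + d *: A + g%:M.
Proof.
have [h h0 fh] := sqmx_hoffman_poly; exists h => //.
have [c [d [g]]] := X_mul_quadratic a b; move: (quadratic a b) => q Xq.
exists c, d, g; rewrite -{1}[A]sqmx_hornerX -sqmx_hornerM Xq -fh.
by rewrite !linearD !linearZ /= sqmx_hornerX sqmx_hornerC.
Qed.

Lemma at_distance3_near u v : at_distance e 3 u v = ~~ near e u v.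
Proof.
rewrite (at_distance3E e_irr) andb_idl // => far.
(* With q = x^2 the product is A^3. At a far pair the right-hand side has entry [h], which is
   nonzero, while without a walk of length 3 the left-hand side has entry 0. *)
have [h h0 [c [d [g /(congr1 (fun M => entry M u v))]]]] := adj_mul_quadratic 0 0.
have [uv euv _] := entry_far far; apply: contra_eqT => no_walk.
rewrite !entryE quadratic_far // uv euv /= !mulr0 !addr0 mulr1.
suff -> : entry (A *m f (quadratic 0 0)) u v = 0 by rewrite eq_sym.
rewrite entry_mul big1 // => w _; rewrite entry_adj sqmx_quadratic !entryE.
have [uw|_] := boolP (e u w); last by rewrite mul0r.
suff -> : entry (A *m A) w v = 0 by rewrite !mul0r !addr0 mulr0.
rewrite entry_adj_sqr; apply/eqP; rewrite pnatr_eq0 cards_eq0.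
apply/eqP/setP => x; rewrite !inE; apply: contraNF no_walk => /andP[wx vx].
rewrite walkSE; apply/existsP; exists w; rewrite uw walk2E.
by apply/existsP; exists x; rewrite wx e_sym.
Qed.

(** A pair at distance at least 4 has no walk of length at most 2, so it is not near; then it is at
    distance 3, a contradiction. *)
Lemma at_distance_le3 i u v : at_distance e i u v -> (i <= 3)%N.
Proof.
move=> iuv; rewrite leqNgt; apply/negP => i4.
have far d : (d < 4)%N -> ~~ walk_of_length e d u v.
  by move=> d4; apply: at_distance_walkN iuv _; apply: leq_trans d4 i4.
have := at_distance3_near u v; rewrite (at_distance3E e_irr) (negPf (far 3%N isT)) /=.
have := (far 0%N isT, far 1%N isT, far 2%N isT); rewrite walk0E walk1E walk2E.
by rewrite (nearE e_irr) => -[[/negPf -> /negPf ->] /negPf ->].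
Qed.

Lemma sum_one : \sum_(u : V) 1 = #|V|%:R :> R.
Proof. exact: sumr_const. Qed.

(** * The bound *)

Definition near_count : R := \sum_u \sum_v (near e u v)%:R.

Lemma near_count_gt0 : 0 < near_count.
Proof.
have : #|V|%:R <= near_count.
  rewrite -sum_one; apply: ler_sum => u _.
  by rewrite (bigD1 u) //= /near eqxx lerDl sumr_ge0.
exact: lt_le_trans card_gt0.
Qed.

Lemma k3_meanE : k3_mean R e = #|V|%:R - near_count / #|V|%:R.
Proof.
have n0 : #|V|%:R != 0 :> R by rewrite gt_eqF ?card_gt0.
apply: (mulIf n0); rewrite mulrBl !divfK //.
rewrite -[X in X * _]sumr_const mulr_suml /near_count -sumrB.
apply: eq_bigr => u _; rewrite mul1r -{1}sum_one -sumrB /k3 -sum_count.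
apply: eq_bigr => v _; rewrite at_distance3_near.
by case: (near e u v); rewrite ?subrr ?subr0.
Qed.

Lemma sum_entry_horner p : \sum_u \sum_v entry (f p) u v = #|V|%:R * p.[theta 0%N].
Proof.
rewrite -sum_one mulr_suml; apply: eq_bigr => u _.
have /(congr1 (fun M => entry M u u)) := f_ones p.
rewrite entryZ entry_const mulr1 mul1r => <-; rewrite entry_mul.
by apply: eq_bigr => w _; rewrite entry_const mulr1.
Qed.

Lemma sum_sqr_entry_horner p :
  \sum_u \sum_v entry (f p) u v ^+ 2 = \sum_(0 <= i < 4) (m i)%:R * p.[theta i] ^+ 2.
Proof.
have := f_trace (p * p); under [RHS]eq_bigr do rewrite hornerM -expr2.
move=> <-; rewrite sqmx_hornerM trace_entry; apply: eq_bigr => u _.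
rewrite entry_mul; apply: eq_bigr => v _; rewrite expr2; congr (_ * _).
by rewrite -{1}(tr_sqmx_horner p symA) /entry mxE.
Qed.

Section Bound.

Variable p : {poly R}.
Hypothesis p_far : forall u v, ~~ near e u v -> entry (f p) u v = 0.

(** Expansion of the squared norm of f p - c N. Since [f p] vanishes outside [near], its inner
    product with N is its entry sum. *)
Lemma sum_sqr_dist_near c :
  \sum_u \sum_v (entry (f p) u v - c * (near e u v)%:R) ^+ 2 =
  \sum_(0 <= i < 4) (m i)%:R * p.[theta i] ^+ 2
    - 2 * c * (#|V|%:R * p.[theta 0%N]) + c ^+ 2 * near_count.
Proof.
rewrite -sum_sqr_entry_horner -sum_entry_horner !mulr_sumr -sumrB -big_split /=.
apply: eq_bigr => u _; rewrite !mulr_sumr -sumrB -big_split /=.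
apply: eq_bigr => v _; have [|/p_far ->] := boolP (near e u v).
  move=> _ /=. ring.
by rewrite /=; ring.
Qed.

Lemma sum_sqr_dist_near0 c :
  \sum_u \sum_v (entry (f p) u v - c * (near e u v)%:R) ^+ 2 = 0 <-> f p = c *: N.
Proof.
split=> [/eqP|->]; last first.
  by rewrite big1 // => u _; rewrite big1 // => v _; rewrite !entryE subrr expr0n.
rewrite psumr_eq0 => [/allP sum0|u _]; last by apply: sumr_ge0 => v _; apply: sqr_ge0.
apply: entryP => u v; have /= := sum0 u (mem_index_enum u).
rewrite psumr_eq0 => [/allP/(_ v (mem_index_enum v))|w _]; last exact: sqr_ge0.
by rewrite /= sqrf_eq0 subr_eq0 !entryE => /eqP.
Qed.

(** [D] below is the defect in the Cauchy-Schwarz inequality for [f p] and N. Divided by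
    [near_count] it is the squared distance from [f p] to the line spanned by N, which gives both
    the sign and the case of equality. *)
Lemma bound_le_eq (T := \sum_(0 <= i < 4) (m i)%:R * p.[theta i] ^+ 2)
    (b := #|V|%:R * (\sum_(1 <= i < 4) (m i)%:R * p.[theta i] ^+ 2) / T) :
  0 < T -> k3_mean R e <= b /\ (k3_mean R e = b <-> exists c, f p = c *: N).
Proof.
move=> T_gt0; have n_gt0 := card_gt0; have S_gt0 := near_count_gt0.
have TE : T = p.[theta 0%N] ^+ 2 + \sum_(1 <= i < 4) (m i)%:R * p.[theta i] ^+ 2.
  by rewrite /T big_ltn // m0 mul1r.
pose D := T * near_count - (#|V|%:R * p.[theta 0%N]) ^+ 2.
have bE : b - k3_mean R e = D / (#|V|%:R * T).
  have -> : b = #|V|%:R * (T - p.[theta 0%N] ^+ 2) / T by rewrite /b TE; congr (_ * _ / _); ring.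
  rewrite k3_meanE /D; field.
  by rewrite !gt_eqF.
(* The coefficient of the orthogonal projection of [f p] onto N. *)
pose c0 := #|V|%:R * p.[theta 0%N] / near_count.
have DE : D / near_count =
    \sum_u \sum_v (entry (f p) u v - c0 * (near e u v)%:R) ^+ 2.
  by rewrite sum_sqr_dist_near -/T /c0 /D; field; rewrite gt_eqF.
have D0 : D = 0 <-> k3_mean R e = b.
  split=> [D0|meanE]; first by apply/eqP; rewrite eq_sym -subr_eq0 bE D0 mul0r.
  move/eqP: bE; rewrite meanE subrr eq_sym mulf_eq0 invr_eq0 mulf_eq0.
  by rewrite (gt_eqF n_gt0) (gt_eqF T_gt0) !orbF => /eqP.
split.
  rewrite -subr_ge0 bE; apply: divr_ge0; last by rewrite mulr_ge0 ?ltW.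
  suff : 0 <= D / near_count by rewrite pmulr_lge0 ?invr_gt0.
  by rewrite DE; apply: sumr_ge0 => u _; apply: sumr_ge0 => v _; apply: sqr_ge0.
rewrite -D0; split=> [D_eq0|[c fpE]].
  by exists c0; apply/sum_sqr_dist_near0; rewrite -DE D_eq0 mul0r.
have sumE : #|V|%:R * p.[theta 0%N] = c * near_count.
  rewrite -sum_entry_horner fpE mulr_sumr; apply: eq_bigr => u _.
  by rewrite mulr_sumr; apply: eq_bigr => v _; rewrite !entryE.
have [_ /(_ fpE)] := sum_sqr_dist_near0 c; rewrite sum_sqr_dist_near -/T /D sumE.
by move=> T0; rewrite -[T](addrK (c ^+ 2 * near_count)); nra.
Qed.

End Bound.

(** The bound depends on [s] only through s - tau. Its denominator is positive because a monic
    quadratic cannot vanish at three eigenvalues. *)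
Lemma k3_bound_le_eq s a b :
  s - (tau #|V| theta m s)%:P = quadratic a b ->
  k3_mean R e <= k3_bound #|V| theta m s /\
  (k3_mean R e = k3_bound #|V| theta m s <-> exists c, f (quadratic a b) = c *: N).
Proof.
move=> sE; have q_far := @quadratic_far a b.
have sum_gt0 : 0 < \sum_(0 <= i < 4) (m i)%:R * (quadratic a b).[theta i] ^+ 2.
  have term_ge0 i : 0 <= (m i)%:R * (quadratic a b).[theta i] ^+ 2.
    by rewrite mulr_ge0 ?sqr_ge0.
  rewrite lt_def sumr_ge0 // andbT psumr_eq0 //.
  apply/negP => /allP q0; apply: (@quadratic_neq0 a b) => i /andP[_ i4].
  have := q0 i; rewrite mem_index_iota => /(_ i4).
  by rewrite mulf_eq0 sqrf_eq0 pnatr_eq0 eqn0Ngt m_gt0 //= => /eqP.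
have := bound_le_eq q_far sum_gt0.
suff -> : k3_bound #|V| theta m s =
  #|V|%:R * (\sum_(1 <= i < 4) (m i)%:R * (quadratic a b).[theta i] ^+ 2) /
    \sum_(0 <= i < 4) (m i)%:R * (quadratic a b).[theta i] ^+ 2 by [].
by rewrite /k3_bound; congr (_ * _ / _); apply: eq_bigr => i _;
  rewrite -sE hornerD hornerN hornerC.
Qed.

(** * The case of equality *)

(** Turns pairwise equality of counts within each class into a function giving the common value, as
    the definitions of regularity require; an empty class gets the value 0. *)
Lemma const_choice (I : Type) (C : I -> rel V) (g : I -> V -> V -> nat) :
  (forall i u v u' v', C i u v -> C i u' v' -> g i u v = g i u' v') ->
  exists b : I -> nat, forall i u v, C i u v -> g i u v = b i.
Proof.
move=> g_const.
exists (fun i => if [pick x : V * V | C i x.1 x.2] is Some x then g i x.1 x.2 else 0%N).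
move=> i u v Cuv; case: pickP => [x /= Cx|/(_ (u, v))]; first exact: g_const Cuv Cx.
by rewrite /= Cuv.
Qed.

Lemma at_distance_class i u v : at_distance e i u v ->
  [/\ (u == v) = (i == 0%N), e u v = (i == 1%N) & near e u v = (i <= 2)%N].
Proof.
move=> iuv; have := at_distance_le3 iuv; move: iuv; case: i => [|[|[|[|]]]] // + _.
- by rewrite at_distance0E => /eqP ->; rewrite /near eqxx e_irr.
- rewrite at_distance1E // => euv; rewrite euv (nearE e_irr) euv orbT; split=> //.
  by apply: contraTF euv => /eqP ->; rewrite e_irr.
- rewrite at_distance2E // => /and3P[uwv /negPf uv /negPf euv].
  by rewrite (nearE e_irr) uv euv uwv.
rewrite at_distance3_near => far; have [-> -> _] := entry_far far.
by rewrite (negPf far).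
Qed.

Lemma adj_dist12 : adjacency_mx R (dist12_graph e) = N - 1%:M.
Proof.
apply: entryP => u v; rewrite !entryE /near mul1r.
have [->|_] := eqVneq u v; last by rewrite subr0.
by rewrite dist12E // e_irr eqxx andbF subrr.
Qed.

Lemma dist12_sym : symmetric (dist12_graph e).
Proof.
move=> u v; have := near_sym u v; rewrite /near [v == u]eq_sym.
by have [->|_] := eqVneq u v.
Qed.

Lemma dist12_loopless u : dist12_graph e u u = false.
Proof. by rewrite dist12E // e_irr eqxx andbF. Qed.

Lemma exists_edge : exists u v : V, e u v.
Proof.
have [/existsP[[u v] /= euv]|] := boolP [exists x : V * V, e x.1 x.2].
  by exists u, v.
rewrite negb_exists => /forallP no_edge.
have /f_eq0 X0 : f 'X = 0.
  rewrite sqmx_hornerX; apply: entryP => u v.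
  by rewrite entry_adj /entry mxE (negPf (no_edge (u, v))).
have [t32 _ _] := theta_lt.
by have := X0 3%N isT; have := X0 2%N isT; rewrite !hornerX; lra.
Qed.

(** * Regularity from a quadratic in A that is a multiple of N *)

Section TwoValued.

Variables a b c t t' : R.
Local Notation q := (quadratic a b).
Hypothesis fq : f q = c *: N.
Hypothesis q_vals : forall i, (0 < i < 4)%N -> (q.[theta i] - t) * (q.[theta i] - t') = 0.

Lemma near_coeff_neq0 : c != 0.
Proof.
apply/eqP => c0; apply: (@quadratic_neq0 a b) => i /andP[_ i4].
by move: i i4; apply/f_eq0; rewrite fq c0 scale0r.
Qed.

Let c_neq0 := near_coeff_neq0.

(** This is the span of the distance matrices, the Bose-Mesner algebra once the graph is known to be
    distance-regular. *)
Definition bose_mesner (M : 'M[R]_#|V|) := exists x y z w,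
  M = x%:M + y *: A + z *: N + w *: J.

Lemma bose_mesnerD M1 M2 : bose_mesner M1 -> bose_mesner M2 -> bose_mesner (M1 + M2).
Proof.
move=> [x [y [z [w ->]]]] [x' [y' [z' [w' ->]]]].
exists (x + x'), (y + y'), (z + z'), (w + w'); apply: entryP => u v.
by rewrite !entryE; ring.
Qed.

Lemma bose_mesnerZ s M : bose_mesner M -> bose_mesner (s *: M).
Proof.
move=> [x [y [z [w ->]]]]; exists (s * x), (s * y), (s * z), (s * w).
by apply: entryP => u v; rewrite !entryE; ring.
Qed.

Lemma bose_mesner1 x : bose_mesner x%:M.
Proof. by exists x, 0, 0, 0; rewrite !scale0r !addr0. Qed.

Lemma bose_mesnerA : bose_mesner A.
Proof. by exists 0, 1, 0, 0; rewrite !scale0r scale1r raddf0 !addr0 add0r. Qed.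

Lemma bose_mesnerN : bose_mesner N.
Proof. by exists 0, 0, 1, 0; rewrite !scale0r scale1r raddf0 !addr0 add0r. Qed.

Lemma bose_mesnerJ : bose_mesner J.
Proof. by exists 0, 0, 0, 1; rewrite !scale0r scale1r raddf0 !addr0 add0r. Qed.

Lemma near_quadratic : N = c^-1 *: f q.
Proof. by rewrite fq scalerA mulVf // scale1r. Qed.

Lemma adj_sqr : A *m A = c *: N - b%:M - a *: A.
Proof. by rewrite -fq sqmx_quadratic !addrK. Qed.

Lemma bose_mesner_mul M : bose_mesner M -> bose_mesner (A *m M).
Proof.
have bmA := bose_mesnerA; have bmN := bose_mesnerN; have bmJ := bose_mesnerJ.
have bm1 := bose_mesner1.
move=> [x [y [z [w ->]]]]; rewrite !mulmxDr -!scalemxAr mul_mx_scalar adj_sqr adj_ones.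
have [h _ [c' [d [g AqE]]]] := adj_mul_quadratic a b.
(* Only the product of A and N needs the cubic relation: N is replaced by a multiple of q(A), and A
   q(A) is reduced to lower terms. *)
rewrite {2}near_quadratic -scalemxAr AqE fq -!scaleN1r.
by do ![apply: bose_mesnerD | apply: bose_mesnerZ].
Qed.

Lemma bose_mesner_tr M : bose_mesner M -> M^T = M.
Proof.
move=> [x [y [z [w ->]]]]; rewrite !linearD !linearZ /= tr_scalar_mx trmx_const.
by rewrite symA (tr_adj near_sym).
Qed.

Lemma bose_mesner_at_distance d : bose_mesner (adjacency_mx R (at_distance e d)).
Proof.
have bmA := bose_mesnerA; have bmN := bose_mesnerN; have bmJ := bose_mesnerJ.
have bm1 := bose_mesner1.
case: d => [|[|[|[|d]]]].
- suff -> : adjacency_mx R (at_distance e 0) = 1%:M by [].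
  by apply: entryP => u v; rewrite !entryE at_distance0E mul1r.
- suff -> : adjacency_mx R (at_distance e 1) = A by [].
  by apply: entryP => u v; rewrite !entryE at_distance1E.
- suff -> : adjacency_mx R (at_distance e 2) = N + (-1) *: 1%:M + (-1) *: A.
    by do ![apply: bose_mesnerD | apply: bose_mesnerZ].
  apply: entryP => u v; rewrite !entryE nearE // at_distance2E //.
  have [->|] := eqVneq u v; first by rewrite e_irr andbF /=; ring.
  have [uv|] := boolP (e u v); first by rewrite andbF /= => _; ring.
  by rewrite andbT /= => _ _; ring.
- suff -> : adjacency_mx R (at_distance e 3) = J + (-1) *: N.
    by do ![apply: bose_mesnerD | apply: bose_mesnerZ].
  apply: entryP => u v; rewrite !entryE at_distance3_near.
  by case: (near e u v) => /=; ring.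
suff -> : adjacency_mx R (at_distance e d.+4) = 0%:M by [].
apply: entryP => u v; rewrite !entryE mul0r.
by case: (boolP (at_distance e d.+4 u v)) => // /at_distance_le3.
Qed.

Lemma bose_mesner_const M i u v u' v' : bose_mesner M ->
  at_distance e i u v -> at_distance e i u' v' -> entry M u v = entry M u' v'.
Proof.
move=> [x [y [z [w ->]]]] /at_distance_class[uvE euvE nuvE].
move=> /at_distance_class[uvE' euvE' nuvE'].
by rewrite !entryE uvE euvE nuvE uvE' euvE' nuvE'.
Qed.

(** The count is an entry of a product of A with a distance matrix. This product lies in the span of
    I, A, N, J, whose entries depend only on the distance. *)
Lemma intersection_number d i u v u' v' :
  at_distance e i u v -> at_distance e i u' v' ->
  #|[set w | e v w & at_distance e d u w]| = #|[set w | e v' w & at_distance e d u' w]|.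
Proof.
have bm_d := bose_mesner_at_distance d; have bm_Ad := bose_mesner_mul bm_d.
(* The count reads the product with A on the right; symmetry of [bose_mesner] matrices moves A to
   the left, where [bose_mesner_mul] applies. *)
have cntE x y : #|[set w | e y w & at_distance e d x w]|%:R =
    entry (A *m adjacency_mx R (at_distance e d)) x y.
  rewrite -{1}(bose_mesner_tr bm_Ad) trmx_mul symA (bose_mesner_tr bm_d).
  rewrite entry_adj_mul; congr (_%:R); apply: eq_card => w.
  by rewrite !inE andbC e_sym.
move=> iuv iuv'; apply/eqP; rewrite -(eqr_nat R) !cntE; apply/eqP.
exact: bose_mesner_const bm_Ad iuv iuv'.
Qed.

Lemma quadratic_distance_regular : graph_connected e -> distance_regular e.
Proof.
move=> e_conn; split=> //.
have [b' b'E] := const_choice (fun i => @intersection_number i.+1 i).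
have [c' c'E] := const_choice (fun i => @intersection_number i.-1 i).
by exists b', c' => i u v iuv; rewrite (b'E _ _ _ iuv) (c'E _ _ _ iuv).
Qed.

(** The polynomial (q - t)(q - t') vanishes at theta_1, theta_2, theta_3, so it evaluates to a
    multiple of [J]; then q(A) is replaced by c N. *)
Lemma near_sqr : exists x y z, N *m N = x *: N + y *: J + z%:M.
Proof.
pose r := q ^+ 2 - (t + t') *: q + (t * t')%:P.
have r_eq0 i : (0 < i < 4)%N -> r.[theta i] = 0.
  move=> /q_vals <-; rewrite /r; move: (quadratic a b) => p; rewrite !hornerE; ring.
have := f_hoffman r_eq0; set h := _ / _ => frE.
exists (c^-1 ^+ 2 * (t + t') * c), (c^-1 ^+ 2 * h), (- (c^-1 ^+ 2 * (t * t'))).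
rewrite {1 2}near_quadratic -scalemxAl -scalemxAr scalerA -sqmx_hornerM -expr2.
have -> : q * q = r - (t * t')%:P + (t + t') *: q by rewrite /r expr2 addrK subrK.
have fE p p' s s' : f (p - s'%:P + s *: p') = f p - s'%:M + s *: f p'.
  by rewrite linearD linearB linearZ /= sqmx_hornerC.
rewrite fE frE fq.
by apply: entryP => u v; rewrite !entryE; ring.
Qed.

Lemma quadratic_strongly_regular : strongly_regular (dist12_graph e).
Proof.
split.
(* The index type [unit] puts all pairs into one class; the degree is the row sum of N - I. *)
- pose g (i : unit) (u v : V) := #|[set w | dist12_graph e u w]|.
  have gE i u v : (g i u v)%:R = c^-1 * q.[theta 0%N] - 1 :> R.
    have -> : (g i u v)%:R = entry (adjacency_mx R (dist12_graph e) *m J) u u.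
      rewrite ones_adj entry_adj_mul; congr (_%:R); apply: eq_card => w.
      by rewrite !inE andbT.
    rewrite adj_dist12 mulmxBl mul1mx near_quadratic -scalemxAl f_ones.
    by rewrite !entryE mulr1.
  have [|k' k'E] := @const_choice unit (fun _ _ _ => true) g.
    by move=> i u v u' v' _ _; apply/eqP; rewrite -(eqr_nat R) !gE.
  by exists (k' tt) => u; apply: (k'E tt u u).
- have [/existsP[[u v] /= far]|] := boolP [exists x : V * V, ~~ near e x.1 x.2].
    by exists u, v; apply/andP; rewrite -negb_or.
  rewrite negb_exists => /forallP all_near.
  (* If all pairs were near, q(A) would be a multiple of [J] and q would vanish at theta_1, theta_2,
     theta_3. *)
  case: (@quadratic_neq0 a b); apply: f_eq_ones c _; rewrite fq; congr (_ *: _).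
  apply: entryP => u v; rewrite !entryE; have := all_near (u, v).
  by rewrite negbK /= => ->.
- by have [u [v euv]] := exists_edge; exists u, v; rewrite dist12E // euv.
have [x [y [z NN]]] := near_sqr.
pose C (B : bool) (u v : V) := (u != v) && (dist12_graph e u v == B).
pose g (B : bool) (u v : V) := #|[set w | dist12_graph e u w & dist12_graph e v w]|.
have [|lm lmE] := @const_choice bool C g.
  (* Off the diagonal, (N - I)^2 = N^2 - 2 N + I has this entry by [near_sqr]. *)
  have gE B u v : C B u v -> (g B u v)%:R = (x - 2) * B%:R + y :> R.
    case/andP=> uv /eqP Buv.
    have -> : (g B u v)%:R =
        entry (adjacency_mx R (dist12_graph e) *m adjacency_mx R (dist12_graph e)) u v.
      rewrite entry_adj_mul; congr (_%:R); apply: eq_card => w.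
      by rewrite !inE [_ w v]dist12_sym.
    rewrite adj_dist12 mulmxBl !mulmxBr !mul1mx mulmx1 NN !entryE /near Buv (negPf uv) /=.
    by ring.
  by move=> B u v u' v' /gE uvE /gE uvE'; apply/eqP; rewrite -(eqr_nat R) uvE uvE'.
exists (lm true), (lm false) => u v uv.
rewrite -[LHS]/(g (dist12_graph e u v) u v) (lmE _ u v) ?/C ?uv ?eqxx //.
by case: (dist12_graph e u v).
Qed.

End TwoValued.

(** * Distance-regular graphs with strongly regular distance-1-or-2 graph *)

(** N dominates I + A entrywise, and the degree is positive. This keeps the denominator of [tau]
    nonzero in [tau_quadratic]. *)
Lemma near_count_gt_card : #|V|%:R < near_count.
Proof.
have k_gt0 : 0 < theta 0%N.
  have [u [v euv]] := exists_edge; rewrite theta0 ltr0n -(e_reg u).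
  by apply/card_gt0P; exists v; rewrite inE.
apply: (@lt_le_trans _ _ (#|V|%:R + #|V|%:R * theta 0%N)).
  by rewrite ltrDl mulr_gt0 ?card_gt0.
have := sum_entry_horner 'X; rewrite hornerX sqmx_hornerX => <-.
rewrite -{1}sum_one -big_split; apply: ler_sum => u _ /=.
have eq_sum : \sum_v (u == v)%:R = 1 :> R.
  by rewrite (bigD1 u) //= eqxx big1 ?addr0 // => v /negPf; rewrite eq_sym => ->.
rewrite -{1}eq_sum -big_split; apply: ler_sum => v _ /=; rewrite entry_adj nearE //.
have [->|_] := eqVneq u v; first by rewrite e_irr /= addr0.
by case: (e u v); rewrite /= add0r // ler0n.
Qed.

Section NearQuadratic.

Variables a b g : R.
Local Notation q := (quadratic a b).
Hypothesis fq : f q = g *: N.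
Hypothesis g_gt0 : 0 < g.

(** Both sides are the trace of q(A) l(A) = g N l(A), where l is the second quadratic: l(A) vanishes
    outside [near], so pairing it with N gives its entry sum. *)
Lemma sum_mult_quadratic c d :
  \sum_(0 <= i < 4) (m i)%:R * (q.[theta i] * (quadratic c d).[theta i]) =
  g * (#|V|%:R * (quadratic c d).[theta 0%N]).
Proof.
have far := @quadratic_far c d; move: (quadratic c d) far => l far.
have := f_trace (q * l); under [RHS]eq_bigr do rewrite hornerM.
move=> <-; rewrite sqmx_hornerM fq -scalemxAl mxtraceZ trace_entry; congr (_ * _).
rewrite -sum_entry_horner [RHS]exchange_big; apply: eq_bigr => u _.
rewrite entry_mul; apply: eq_bigr => v _; rewrite entry_adj.
have [_|] := boolP (near e u v); first by rewrite mul1r.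
by rewrite near_sym => /far ->; rewrite mulr0.
Qed.

(* With l = (x - theta_0)(x - y) the right-hand side of [sum_mult_quadratic]
   vanishes: q is orthogonal to polynomials of degree at most 1 for the weights
   m_i (theta_0 - theta_i), and hence changes sign twice on
   theta_3 < theta_2 < theta_1. *)
Lemma quadratic_orthogonal y :
  \sum_(1 <= i < 4)
    (m i)%:R * (theta 0%N - theta i) * (theta i - y) * q.[theta i] = 0.
Proof.
have l0 : (quadratic (- (theta 0%N + y)) (theta 0%N * y)).[theta 0%N] = 0.
  by rewrite horner_quadratic; ring.
have := sum_mult_quadratic (- (theta 0%N + y)) (theta 0%N * y).
rewrite big_ltn // l0.
rewrite !mulr0 add0r => sum0; apply/eqP; rewrite -oppr_eq0 -sumrN; apply/eqP.
rewrite -[RHS]sum0; apply: eq_bigr => i _.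
by rewrite [(quadratic (- _) _).[_]]horner_quadratic; ring.
Qed.

(** If q agreed at two consecutive eigenvalues, orthogonality with y the third one would leave their
    common value times a nonzero number, so q vanishes at both. A second choice of y kills the
    remaining value, contradicting [quadratic_neq0]. *)
Lemma quadratic_separates i : (1 < i < 4)%N -> q.[theta i] != q.[theta i.-1].
Proof.
have weight_gt0 j : (0 < j < 4)%N -> 0 < (m j)%:R * (theta 0%N - theta j).
  case/andP=> j0 j4; rewrite mulr_gt0 ?ltr0n ?m_gt0 // subr_gt0.
  have [t32 t21 t10] := theta_lt.
  by move: j j0 j4 => [|[|[|[|]]]] // _ _; lra.
have [t32 t21 t10] := theta_lt.
have := weight_gt0 1%N isT; have := weight_gt0 2%N isT; have := weight_gt0 3%N isT.
have := quadratic_orthogonal; have q_neq0 := @quadratic_neq0 a b; move: q_neq0.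
move: (quadratic a b) => p p_neq0.
set w1 := (m 1)%:R * _; set w2 := (m 2)%:R * _; set w3 := (m 3)%:R * _.
move=> orth w3_gt0 w2_gt0 w1_gt0 i4; apply/eqP => eq_p.
have {}orth y : w1 * (theta 1%N - y) * p.[theta 1%N] +
    (w2 * (theta 2%N - y) * p.[theta 2%N] + w3 * (theta 3%N - y) * p.[theta 3%N]) = 0.
  by have := orth y; rewrite 3?big_ltn // big_geq // addr0.
clearbody w1 w2 w3.
apply: p_neq0; case: i i4 eq_p => [|[|[|[|]]]] // _ /= eq_p.
  have p1 : p.[theta 1%N] = 0.
    have := orth (theta 3%N); rewrite eq_p subrr mulr0 mul0r addr0 -mulrDl => /eqP.
    rewrite mulf_eq0 gt_eqF => [/eqP //|]; last by rewrite addr_gt0 ?mulr_gt0 //; lra.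
  have p3 : p.[theta 3%N] = 0.
    have := orth (theta 1%N); rewrite eq_p p1 !mulr0 !add0r => /eqP.
    rewrite mulf_eq0 lt_eqF => [/eqP //|]; last by rewrite pmulr_rlt0 //; lra.
  by case=> [|[|[|[|]]]] // _; rewrite ?eq_p.
have p2 : p.[theta 2%N] = 0.
  have := orth (theta 1%N); rewrite eq_p subrr mulr0 mul0r add0r -mulrDl => /eqP.
  rewrite mulf_eq0 lt_eqF => [/eqP //|].
  by rewrite -[X in _ < X]addr0 ltrD ?pmulr_rlt0 //; lra.
have p1 : p.[theta 1%N] = 0.
  have := orth (theta 3%N); rewrite eq_p p2 !mulr0 !addr0 => /eqP.
  rewrite mulf_eq0 gt_eqF => [/eqP //|]; last by rewrite mulr_gt0 //; lra.
by case=> [|[|[|[|]]]] // _; rewrite ?eq_p.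
Qed.

(** Strong regularity gives a quadratic relation for N modulo [J], hence one quadratic equation
    satisfied by q at theta_1, theta_2, theta_3. As q(theta_2) differs from the other two values,
    these must coincide. *)
Lemma strongly_regular_quadratic :
  strongly_regular (dist12_graph e) -> q.[theta 1%N] = q.[theta 3%N].
Proof.
case=> [[kB B_reg] _ _ [la [mu B_common]]].
have NN : N *m N = (2 + la%:R - mu%:R) *: N + mu%:R *: J +
    (kB%:R - 1 - la%:R)%:M.
  have -> : N = adjacency_mx R (dist12_graph e) + 1%:M by rewrite adj_dist12 subrK.
  rewrite mulmxDl mulmxDr mulmx1 mul1mx; apply: entryP => u v.
  have BB : entry (adjacency_mx R (dist12_graph e) *m adjacency_mx R (dist12_graph e)) u v
      = #|[set w | dist12_graph e u w & dist12_graph e v w]|%:R.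
    rewrite entry_adj_mul; congr (_%:R); apply: eq_card => w.
    by rewrite !inE [_ w v]dist12_sym.
  rewrite !entryE BB; have [<-|uv] := eqVneq u v.
    rewrite dist12_loopless.
    have -> : #|[set w | dist12_graph e u w & dist12_graph e u w]| = kB.
      by rewrite -(B_reg u); apply: eq_card => w; rewrite !inE andbb.
    by rewrite /=; ring.
  by rewrite B_common //; case: (dist12_graph e u v) => /=; ring.
have vals i : (0 < i < 4)%N -> q.[theta i] ^+ 2
    = (2 + la%:R - mu%:R) * g * q.[theta i] + (kB%:R - 1 - la%:R) * g ^+ 2.
  set x := 2 + la%:R - mu%:R in NN *; set z := kB%:R - 1 - la%:R in NN *.
  move=> i4; apply/eqP; rewrite -subr_eq0; apply/eqP.
  have fr : f (q * q - ((x * g) *: q + (z * g ^+ 2)%:P)) = (g ^+ 2 * mu%:R) *: J.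
    move: fq; move: (quadratic a b) => p fp.
    rewrite linearB linearD linearZ /= sqmx_hornerM sqmx_hornerC fp.
    rewrite -scalemxAl -scalemxAr scalerA NN; apply: entryP => u v.
    by rewrite !entryE; ring.
  have := f_eq_ones fr i4; move: (quadratic a b) => p.
  by rewrite !hornerE -expr2.
have := vals 1%N isT; have := vals 2%N isT; have := vals 3%N isT.
have := quadratic_separates (isT : (1 < 2 < 4)%N).
have := quadratic_separates (isT : (1 < 3 < 4)%N) => /=.
set x := (_ * g); set z := (_ * g ^+ 2).
move: q.[theta 1%N] q.[theta 2%N] q.[theta 3%N] x z => v1 v2 v3 x z.
rewrite -subr_eq0 => v32; rewrite -subr_eq0 => v21 e3 e2 e1.
(* Subtracting the equations in pairs gives v3 + v2 = x = v2 + v1. *)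
have : (v3 - v2) * (v3 + v2 - x) = 0.
  by have -> : (v3 - v2) * (v3 + v2 - x) = (v3 ^+ 2 - x * v3) - (v2 ^+ 2 - x * v2);
    [ring | rewrite e3 e2; ring].
have : (v2 - v1) * (v2 + v1 - x) = 0.
  by have -> : (v2 - v1) * (v2 + v1 - x) = (v2 ^+ 2 - x * v2) - (v1 ^+ 2 - x * v1);
    [ring | rewrite e2 e1; ring].
move=> /eqP; rewrite mulf_eq0 (negPf v21) /= => /eqP s21.
move=> /eqP; rewrite mulf_eq0 (negPf v32) /= => /eqP s32.
by lra.
Qed.

(* [tau] is the shift at which the bound is stationary, so it recovers the
   constant term of q; the two trace identities are tr N = n and tr N^2 = sum N. *)
Lemma tau_quadratic d : tau #|V| theta m (q + d%:P) = d.
Proof.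
have trq : q.[theta 0%N] + \sum_(1 <= i < 4) (m i)%:R * q.[theta i] = g * #|V|%:R.
  have := f_trace q; rewrite fq mxtraceZ trace_entry.
  under eq_bigr do rewrite entry_adj /near eqxx.
  by rewrite sum_one => ->; rewrite [in RHS]big_ltn // m0 mul1r.
have trq2 : q.[theta 0%N] ^+ 2 + \sum_(1 <= i < 4) (m i)%:R * q.[theta i] ^+ 2
    = g * (#|V|%:R * q.[theta 0%N]).
  have := sum_mult_quadratic a b; rewrite big_ltn // m0 mul1r -expr2 => <-.
  by congr (_ + _); apply: eq_bigr => i _; rewrite expr2.
have summ : \sum_(1 <= i < 4) (m i)%:R = #|V|%:R - 1 :> R.
  by have := sum_m; rewrite big_ltn // m0 => <-; rewrite addrAC subrr add0r.
have q0_gt : g < q.[theta 0%N].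
  have nq0 : #|V|%:R * q.[theta 0%N] = g * near_count.
    rewrite -sum_entry_horner fq mulr_sumr; apply: eq_bigr => u _.
    by rewrite mulr_sumr; apply: eq_bigr => v _; rewrite !entryE.
  by rewrite -(ltr_pM2l card_gt0) nq0 mulrC ltr_pM2l // near_count_gt_card.
have sE i : (q + d%:P).[theta i] = q.[theta i] + d by rewrite hornerD hornerC.
move: trq trq2 q0_gt sE; move: (quadratic a b) => p trq trq2 p0_gt sE.
have s_sum : \sum_(1 <= i < 4) (m i)%:R * (p + d%:P).[theta i] =
    \sum_(1 <= i < 4) (m i)%:R * p.[theta i] + d * (#|V|%:R - 1).
  rewrite -summ mulr_sumr -big_split; apply: eq_bigr => i _ /=.
  by rewrite sE; ring.
have s_sum2 : \sum_(1 <= i < 4) (m i)%:R * (p + d%:P).[theta i] ^+ 2 =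
    \sum_(1 <= i < 4) (m i)%:R * p.[theta i] ^+ 2 +
    2 * d * \sum_(1 <= i < 4) (m i)%:R * p.[theta i] + d ^+ 2 * (#|V|%:R - 1).
  rewrite -summ !mulr_sumr -!big_split; apply: eq_bigr => i _ /=.
  by rewrite sE; ring.
rewrite /tau s_sum s_sum2 sE.
have -> : \sum_(1 <= i < 4) (m i)%:R * p.[theta i] = g * #|V|%:R - p.[theta 0%N].
  by rewrite -trq addrC addKr.
have -> : \sum_(1 <= i < 4) (m i)%:R * p.[theta i] ^+ 2 =
    g * (#|V|%:R * p.[theta 0%N]) - p.[theta 0%N] ^+ 2.
  by rewrite -trq2 addrC addKr.
have denom_neq0 : #|V|%:R * (p.[theta 0%N] - g) != 0.
  by rewrite mulf_neq0 ?(gt_eqF card_gt0) // subr_eq0 gt_eqF.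
apply: (mulIf denom_neq0); rewrite -[in RHS]mulrC.
set D := (X in _ / X); have -> : D = #|V|%:R * (p.[theta 0%N] - g) by rewrite /D; ring.
by rewrite divfK //; ring.
Qed.

End NearQuadratic.

(** This is A^2 = k I + a_1 A + c_2 A_2 with A_2 = N - I - A and a_1 = k - b_1 - c_1. *)
Lemma distance_regular_quadratic : distance_regular e ->
  exists a b g, 0 < g /\ f (quadratic a b) = g *: N.
Proof.
case=> _ [b [c bcE]].
pose la : R := k%:R - (b 1%N)%:R - (c 1%N)%:R; pose g : R := (c 2%N)%:R.
have fq : f (quadratic (g - la) (g - k%:R)) = g *: N.
  rewrite sqmx_quadratic; apply: entryP => u v.
  have [|far] := boolP (near e u v); last first.
    by have [uv euv sq0] := entry_far far; rewrite !entryE uv euv (negPf far) sq0 /=; ring.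
  move=> nuv; rewrite !entryE nuv; have [<-|uv] := eqVneq u v.
    by rewrite entry_adj_sqr_diag e_irr /=; ring.
  have [euv|neuv] := boolP (e u v).
    have uv1 : at_distance e 1 u v by rewrite at_distance1E.
    have [b1 c1] := bcE _ _ _ uv1.
    (* The neighbours of [v] are split by their distance 1, 2 or 0 from [u]. *)
    have count : k%:R = entry (A *m A) u v + (b 1%N)%:R + (c 1%N)%:R.
      rewrite entry_adj_sqr -(e_reg v) -b1 -c1 -!sum_count -!big_split /=.
      apply: eq_bigr => w _; rewrite at_distance2E // at_distance0E.
      have [vw|] := boolP (e v w); last by rewrite andbF !addr0.
      have path : [exists x, e u x && e x w] by apply/existsP; exists v; rewrite euv.
      rewrite path; have [<-|_] := eqVneq u w; first by rewrite e_irr /= !add0r.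
      by case: (e u w) => /=; rewrite !addr0 ?add0r.
    by rewrite /la count /=; ring.
  have uv2 : at_distance e 2 u v.
    by move: nuv; rewrite (nearE e_irr) at_distance2E // (negPf uv) (negPf neuv) andbT.
  have [_ c2] := bcE _ _ _ uv2.
  suff -> : entry (A *m A) u v = g by rewrite /=; ring.
  rewrite entry_adj_sqr /g -c2; congr (_%:R); apply: eq_card => w.
  by rewrite !inE at_distance1E // andbC.
exists (g - la), (g - k%:R), g; split=> //.
by rewrite lt_def (near_coeff_neq0 fq) ler0n.
Qed.

(** * Equality for the two polynomials of the theorem *)

Lemma s1_quadratic d : exists b,
  s1 #|V| theta m - d%:P = quadratic (- (theta 1%N + theta 3%N)) b.
Proof.
rewrite /s1; set c := _ + theta 2%N * _; exists (c - d).
by rewrite /quadratic polyCB scaleNr addrA.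
Qed.

Lemma s2_quadratic d : exists b,
  s2 #|V| theta m - d%:P = quadratic (- (theta 1%N + theta 2%N)) b.
Proof.
rewrite /s2; set c := _ + theta 3%N * _; exists (c - d).
by rewrite /quadratic polyCB scaleNr addrA.
Qed.

(** From q(theta_1) = q(theta_3) the linear coefficients of q and [s1] agree; [tau_quadratic]
    identifies the constant by which they differ with [tau], so s1 - tau is q itself. *)
Lemma k3_mean_eq_of_regular : distance_regular e ->
  strongly_regular (dist12_graph e) ->
  k3_mean R e = k3_bound #|V| theta m (s1 #|V| theta m).
Proof.
move=> /distance_regular_quadratic[a [b [g [g_gt0 fq]]]].
move=> /(strongly_regular_quadratic fq) q13.
have [t32 t21 t10] := theta_lt.
have aE : a = - (theta 1%N + theta 3%N).
  by apply: quadratic_roots_eq q13; rewrite gt_eqF //; lra.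
have [c] := s1_quadratic 0; rewrite polyC0 subr0 -aE => s1E.
have s1q : s1 #|V| theta m = quadratic a b + (c - b)%:P.
  by rewrite s1E /quadratic polyCB addrCA addrK addrC.
have tauE : tau #|V| theta m (s1 #|V| theta m) = c - b.
  by rewrite s1q (tau_quadratic fq g_gt0).
have [|_ ->] := @k3_bound_le_eq (s1 #|V| theta m) a b; last by exists g.
by rewrite tauE {1}s1q addrK.
Qed.

(** Used with j = 3 for [s1] and j = 2 for [s2]. The linear coefficient makes q agree at theta_1 and
    theta_j, so q takes at most two values on theta_1, theta_2, theta_3. *)
Lemma regular_of_k3_mean_eq s a b j : (1 < j < 4)%N -> graph_connected e ->
  s - (tau #|V| theta m s)%:P = quadratic a b -> a = - (theta 1%N + theta j) ->
  k3_mean R e = k3_bound #|V| theta m s ->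
  distance_regular e /\ strongly_regular (dist12_graph e).
Proof.
move=> j4 e_conn sE aE; have [_ ->] := k3_bound_le_eq sE; case=> c fq.
have eq_vals : (quadratic a b).[theta j] = (quadratic a b).[theta 1%N].
  by rewrite !horner_quadratic aE; ring.
(* For j = 2 or 3, the index 5 - j is the remaining one. *)
have vals i : (0 < i < 4)%N ->
    ((quadratic a b).[theta i] - (quadratic a b).[theta 1%N]) *
    ((quadratic a b).[theta i] - (quadratic a b).[theta (5 - j)%N]) = 0.
  move=> i4; apply/eqP; rewrite mulf_eq0 !subr_eq0.
  have [->|->|->] : [\/ i = 1%N, i = j | i = (5 - j)%N].
    by move: j4 i4; case: (j) => [|[|[|[|]]]] //; case: i => [|[|[|[|]]]] // _ _;
      [constructor 1 | constructor 2 | constructor 3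
      |constructor 1 | constructor 3 | constructor 2].
  - by rewrite eqxx.
  - by rewrite eq_vals eqxx.
  by rewrite eqxx orbT.
split; first exact: quadratic_distance_regular fq e_conn.
exact: quadratic_strongly_regular fq vals.
Qed.

End Graph.

Theorem theorem9 (R : rcfType) (V : finType) (e : rel V)
    (e_sym : symmetric e) (e_irr : irreflexive e)
    (k : nat) (theta : nat -> R) (m : nat -> nat)
    (e_conn : graph_connected e) (e_reg : regular_of_degree e k)
    (e_spec : has_spectrum4 e theta m)
    (theta0 : theta 0%N = k%:R) (m0 : m 0%N = 1%N) :
  [/\ k3_mean R e <= k3_bound #|V| theta m (s1 #|V| theta m),
      k3_mean R e <= k3_bound #|V| theta m (s2 #|V| theta m)
    & k3_mean R e = k3_bound #|V| theta m (s1 #|V| theta m) \/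
      k3_mean R e = k3_bound #|V| theta m (s2 #|V| theta m)
      <->
      distance_regular e /\ strongly_regular (dist12_graph e)].
Proof.
have [b1 s1E] := s1_quadratic V theta m (tau #|V| theta m (s1 #|V| theta m)).
have [b2 s2E] := s2_quadratic V theta m (tau #|V| theta m (s2 #|V| theta m)).
have bound := k3_bound_le_eq e_sym e_irr e_reg e_spec theta0 m0.
have regular := regular_of_k3_mean_eq e_sym e_irr e_reg e_spec theta0 m0.
split; [exact: (bound _ _ _ s1E).1 | exact: (bound _ _ _ s2E).1 |].
split=> [[] | [dr sr]].
- exact: (regular _ _ _ 3%N) s1E erefl.
- exact: (regular _ _ _ 2%N) s2E erefl.
by left; apply: (k3_mean_eq_of_regular e_sym e_irr e_reg e_spec theta0 m0 dr sr).
Qed.
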